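(* Let $n\ge3$. Then $Inn_l(Q_n)$ $(=Inn_r(Q_n))$ is an elementary abelian $2$-group of order $2^{2^{n-1}-1}$.
   Context: Cayley--Dickson loops: $Q_0=\{1,-1\}\subset\mathbb{R}$ with conjugation $x^*=x$. For $n\ge1$, $Q_n=\{(x,0),(x,1)\mid x\in Q_{n-1}\}$ with multiplication $(x,0)(y,0)=(xy,0)$, $(x,0)(y,1)=(yx,1)$, $(x,1)(y,0)=(xy^*,1)$, $(x,1)(y,1)=(-y^*x,0)$ and conjugation $(x,0)^*=(x^*,0)$, $(x,1)^*=(-x,1)$, where $-(x,a)=(-x,a)$. $Q_n$ is a loop with neutral element $1=(1,0,\dots,0)$. For a loop $Q$: $L_x(a)=xa$, $Mlt_l(Q)=\langle L_x\mid x\in Q\rangle$ and $Inn_l(Q)=\{f\in Mlt_l(Q)\mid f(1)=1\}$; analogously $Inn_r(Q)$ with right translations $R_x(a)=ax$. *)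

(* Defs.v *)
From HB Require Import structures.
From mathcomp Require Import all_boot all_order all_fingroup all_solvable.
Set Implicit Arguments. Unset Strict Implicit. Unset Printing Implicit Defensive.

(* Carrier of Q_n: Q_0 = bool (false = 1, true = -1); Q_{n+1} = Q_n * bool,
   where (x, false) is (x,0) and (x, true) is (x,1). *)
Fixpoint Qt (n : nat) : finType :=
  match n with 0 => bool | n'.+1 => (Qt n' * bool)%type end.

Fixpoint qone (n : nat) : Qt n :=
  match n return Qt n with 0 => false | n'.+1 => (qone n', false) end.

Fixpoint qneg (n : nat) : Qt n -> Qt n :=
  match n return Qt n -> Qt n with
  | 0 => negb
  | n'.+1 => fun x => (qneg x.1, x.2)
  end.

Fixpoint qconj (n : nat) : Qt n -> Qt n :=
  match n return Qt n -> Qt n with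
  | 0 => id
  | n'.+1 => fun x => if x.2 then (qneg x.1, true) else (qconj x.1, false)
  end.

(* multiplication: on Q_0 = {1,-1} the real product (xor of signs);
   (x,0)(y,0)=(xy,0), (x,0)(y,1)=(yx,1), (x,1)(y,0)=(xy*,1), (x,1)(y,1)=(-y*x,0) *)
Fixpoint qmul (n : nat) : Qt n -> Qt n -> Qt n :=
  match n return Qt n -> Qt n -> Qt n with
  | 0 => addb
  | n'.+1 => fun u v =>
      match u.2, v.2 with
      | false, false => (qmul u.1 v.1, false)
      | false, true  => (qmul v.1 u.1, true)
      | true,  false => (qmul u.1 (qconj v.1), true)
      | true,  true  => (qneg (qmul (qconj v.1) u.1), false)
      end
  end.

Definition Ltrans (n : nat) : {set {perm Qt n}} :=
  [set f : {perm Qt n} | [exists x : Qt n, [forall a : Qt n, f a == qmul x a]]].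
Definition Rtrans (n : nat) : {set {perm Qt n}} :=
  [set f : {perm Qt n} | [exists x : Qt n, [forall a : Qt n, f a == qmul a x]]].

Definition Mlt_l (n : nat) : {set {perm Qt n}} := <<Ltrans n>>%g.
Definition Mlt_r (n : nat) : {set {perm Qt n}} := <<Rtrans n>>%g.

Definition Inn_l (n : nat) : {set {perm Qt n}} :=
  [set f in Mlt_l n | f (qone n) == qone n].
Definition Inn_r (n : nat) : {set {perm Qt n}} :=
  [set f in Mlt_r n | f (qone n) == qone n].

(* Main.v *)
Require Import Defs.
From mathcomp Require Import all_boot all_order all_fingroup all_solvable.
Set Implicit Arguments. Unset Strict Implicit. Unset Printing Implicit Defensive.

(** Modulo signs [Q_n] is the elementary abelian group [V n], so an element of
    the left multiplication group fixing [1] is a sign change [x |-> (-1)^(s x) x]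
    with [s] a function on [V n]; such maps commute and square to the identity.
    Put [n = m+1].  The composite of two left translations is a left translation
    twisted by an associator sign [s], and every such [s] has even weight on
    [V m x {0}] (the rows of the cocycle have even weight for [m >= 2]) and agrees
    on [V m x {1}] with its values on [V m x {0}] up to a global sign.  Conversely
    [L_(x,1) L_(1,1)] differs from [L_(x,0)] by the sign change supported on
    [{0, x} x {0, 1}]; these generate all even-weight functions copied to both
    halves, and the associator with two anticommuting elements provides the
    relative sign of the halves.  So the possible [s] with [s 0 = 0] number
    [2^(2^m - 2) * 2].  Finally [R_x] is the conjugate of a left translation by
    the conjugation of [Q_n], itself a sign change commuting with these maps. *)

(** * The quotient modulo signs and its cocycle *)

Fixpoint V (n : nat) : finType :=
  match n with 0 => unit | n'.+1 => (V n' * bool)%type end.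

Fixpoint v0 (n : nat) : V n :=
  match n return V n with 0 => tt | n'.+1 => (v0 n', false) end.

Fixpoint vadd (n : nat) : V n -> V n -> V n :=
  match n return V n -> V n -> V n with
  | 0 => fun _ _ => tt
  | n'.+1 => fun x y => (vadd x.1 y.1, x.2 (+) y.2)
  end.

(** The exponent of $-1$ in $x^*=\pm x$. *)
Fixpoint conj_sign (n : nat) : V n -> bool :=
  match n return V n -> bool with
  | 0 => fun _ => false
  | n'.+1 => fun x => x.2 || conj_sign x.1
  end.

(* The cocycle of the central extension [{1, -1} -> Q_n -> V n]; signs are
   written additively, [true] standing for [-1]. *)
Fixpoint eps (n : nat) : V n -> V n -> bool :=
  match n return V n -> V n -> bool with
  | 0 => fun _ _ => false
  | n'.+1 => fun x y =>
      match x.2, y.2 with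
      | false, false => eps x.1 y.1
      | false, true  => eps y.1 x.1
      | true,  false => conj_sign y.1 (+) eps x.1 y.1
      | true,  true  => ~~ (conj_sign y.1 (+) eps y.1 x.1)
      end
  end.

Lemma vaddC n : commutative (@vadd n).
Proof. by elim: n => //= n IH [x a] [y b] /=; rewrite IH addbC. Qed.

Lemma vaddA n : associative (@vadd n).
Proof. by elim: n => //= n IH [x a] [y b] [z c] /=; rewrite IH addbA. Qed.

Lemma vadd0v n : left_id (v0 n) (@vadd n).
Proof. by elim: n => [[]|n IH [x a]] //=; rewrite IH. Qed.

Lemma vaddvv n (x : V n) : vadd x x = v0 n.
Proof. by elim: n x => //= n IH [x a] /=; rewrite IH addbb. Qed.

Lemma vaddK n (x : V n) : involutive (vadd x).
Proof. by move=> y; rewrite vaddA vaddvv vadd0v. Qed.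

Lemma vaddI n (x : V n) : injective (vadd x).
Proof. exact: inv_inj (vaddK x). Qed.

Lemma vadd_eq0 n (x y : V n) : (vadd x y == v0 n) = (y == x).
Proof. by rewrite -(vaddvv x) (inj_eq (@vaddI n x)). Qed.

Lemma conj_signE n (x : V n) : conj_sign x = (x != v0 n).
Proof.
elim: n x => [[]|n IH [x a]] //=.
by rewrite IH -pair_eqE /pair_eq /=; case: a; rewrite ?andbF ?andbT.
Qed.

Lemma eps0v n (x : V n) : eps (v0 n) x = false /\ eps x (v0 n) = false.
Proof.
elim: n x => [|n IH] //= [x b]; have c0 : conj_sign (v0 n) = false.
  by rewrite conj_signE eqxx.
by have [IH1 IH2] := IH x; case: b; rewrite /= ?c0 ?IH1 ?IH2.
Qed.

Ltac case_bools := repeat match goal with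
  | |- context [eps ?x ?y] => move: (eps x y); case
  | |- context [conj_sign ?x] => move: (conj_sign x); case
  end; by [].

(* The sign form of [(xy)^* = y^* x^*]. *)
Lemma epsC n (x y : V n) :
  eps y x = eps x y (+) (conj_sign x (+) conj_sign y (+) conj_sign (vadd x y)).
Proof.
elim: n x y => [|n IH] //= [x a] [y b]; case: a; case: b => /=;
  rewrite ?(IH x y) //; case_bools.
Qed.

(** * Parity of the rows and columns of the cocycle *)

Lemma big_addb_pair n (F : V n.+1 -> bool) :
  \big[addb/false]_x F x
    = (\big[addb/false]_x F (x, false)) (+) (\big[addb/false]_x F (x, true)).
Proof.
rewrite -big_split /=.
transitivity (\big[addb/false]_(p : V n * bool) F (p.1, p.2)).
  by apply: eq_bigr => -[].
rewrite -(pair_bigA _ (fun x b => F (x, b))) /=.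
by apply: eq_bigr => x _; rewrite big_bool addbC.
Qed.

Lemma big_addb_const n b : 0 < n -> \big[addb/false]_(x : V n) b = false.
Proof. by case: n => // n _; rewrite big_addb_pair addbb. Qed.

Lemma big_vadd n (x : V n) (F : V n -> bool) :
  \big[addb/false]_y F (vadd x y) = \big[addb/false]_y F y.
Proof. exact/esym/(reindex_inj (@vaddI n x)). Qed.

(** In the sum of [epsC] over [y] the constant term vanishes, as [V n] has even size, and
    translation by [x] makes the other two cancel. *)
Lemma eps_col_sum n (x : V n) : 0 < n ->
  \big[addb/false]_y eps y x = \big[addb/false]_y eps x y.
Proof.
move=> n_gt0; under eq_bigr => y _ do rewrite epsC.
rewrite !big_split /= big_addb_const // (big_vadd x (@conj_sign _)).
by rewrite addFb addbb addbF.
Qed.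

(** The halves of a row come from a row and the matching column one level down, whose sums agree;
    extra conjugation signs occur twice. *)
Lemma eps_row_sum0 n (x : V n) : 1 < n -> \big[addb/false]_y eps x y = false.
Proof.
case: n x => // n x n_gt0; rewrite big_addb_pair; case: x => x [] /=; last first.
  by rewrite eps_col_sum // addbb.
under [X in _ (+) X]eq_bigr => y _ do rewrite -addTb.
rewrite !big_split /= big_addb_const // eps_col_sum //.
by rewrite addFb addbb.
Qed.

Lemma eps_col_sum0 n (x : V n) : 1 < n -> \big[addb/false]_y eps y x = false.
Proof. by move=> n_gt1; rewrite eps_col_sum ?eps_row_sum0 // ltnW. Qed.

(** * Associator signs as words *)

(* The sign of [z(xy)] relative to [(zx)y]. *)
Definition assoc_sign n (z x y : V n) : bool :=
  eps x y (+) eps z (vadd x y) (+) (eps z x (+) eps (vadd z x) y).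

Definition code n (c : bool) (s : V n.+1 -> bool) : Prop :=
  (forall y, s (y, true) = s (y, false) (+) c)
  /\ \big[addb/false]_y s (y, false) = false.

Lemma codeD n c d (s t : V n.+1 -> bool) :
  code c s -> code d t -> code (c (+) d) (fun v => s v (+) t v).
Proof.
move=> [s1 s2] [t1 t2]; split; last by rewrite big_split /= s2 t2.
by move=> y; rewrite s1 t1 addbACA.
Qed.

Lemma code_const n b : 0 < n -> code false (fun _ : V n.+1 => b).
Proof. by move=> n_gt0; split=> [y|]; rewrite ?addbF ?big_addb_const. Qed.

(** By [epsC] the halves differ by the commutator sign of [z] and [x]. The first half sums rows and
    columns of [eps], constants and paired conjugation signs, all of total zero. *)
Lemma code_assoc_sign n (z x : V n) (a b : bool) : 1 < n ->
  code (conj_sign z (+) conj_sign x (+) conj_sign (vadd z x))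
    (@assoc_sign n.+1 (z, a) (x, b)).
Proof.
move=> n_gt1; have n_gt0 := ltnW n_gt1; split=> [y|]; rewrite /assoc_sign.
  case: a; case: b; cbn [eps vadd conj_sign fst snd addb orb negb];
    rewrite (epsC x y) (epsC z (vadd x y)) (epsC (vadd z x) y) vaddA; case_bools.
have colE : \big[addb/false]_y eps (vadd x y) z = false.
  by rewrite (big_vadd x (fun y => eps y z)) eps_col_sum0.
case: a; case: b; cbn [eps vadd conj_sign fst snd addb orb negb].
all: under eq_bigr => y _ do rewrite -?addTb.
all: rewrite !big_split /= ?(big_vadd x (eps z)) ?(big_vadd x (@conj_sign _)).
all: rewrite ?colE ?eps_row_sum0 ?eps_col_sum0 ?big_addb_const //.
all: by case: (\big[addb/false]_y conj_sign y).
Qed.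

(** * Signed coordinates on the loop *)

Fixpoint vec (n : nat) : Qt n -> V n :=
  match n return Qt n -> V n with
  | 0 => fun _ => tt
  | n'.+1 => fun x => (vec x.1, x.2)
  end.

Fixpoint sg (n : nat) : Qt n -> bool :=
  match n return Qt n -> bool with 0 => id | n'.+1 => fun x => sg x.1 end.

Fixpoint mk (n : nat) : bool -> V n -> Qt n :=
  match n return bool -> V n -> Qt n with
  | 0 => fun b _ => b
  | n'.+1 => fun b x => (mk b x.1, x.2)
  end.

Lemma vec_mk n b (v : V n) : vec (mk b v) = v.
Proof. by elim: n v => [[]|n IH [x a]] //=; rewrite IH. Qed.

Lemma sg_mk n b (v : V n) : sg (mk b v) = b.
Proof. by elim: n v => //= n IH [x a]; rewrite IH. Qed.

Lemma mkK n (x : Qt n) : mk (sg x) (vec x) = x.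
Proof. by elim: n x => //= n IH [x a] /=; rewrite IH. Qed.

Lemma mk_one n : qone n = mk false (v0 n).
Proof. by elim: n => //= n ->. Qed.

Lemma neg_mk n b (v : V n) : qneg (mk b v) = mk (~~ b) v.
Proof. by elim: n v => //= n IH [x a] /=; rewrite IH. Qed.

Lemma conj_mk n b (v : V n) : qconj (mk b v) = mk (b (+) conj_sign v) v.
Proof.
elim: n v => [|n IH] /=; first by move=> _; rewrite addbF.
by case=> x [] /=; rewrite ?IH // neg_mk addbT.
Qed.

Lemma mul_mk n a b (u v : V n) :
  qmul (mk a u) (mk b v) = mk (a (+) b (+) eps u v) (vadd u v).
Proof.
elim: n a b u v => [|n IH] /= a b; first by rewrite addbF.
case=> x i [y j]; case: i; case: j; rewrite /= ?conj_mk ?IH ?neg_mk //;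
  rewrite ?(vaddC y x) ?(addbC b a) //; congr (mk _ _, _);
  by case: a; case: b; case: (conj_sign _); case: (eps _ _).
Qed.

(** * Sign changes as permutations *)

Definition Dfun n (s : V n -> bool) (x : Qt n) : Qt n :=
  mk (sg x (+) s (vec x)) (vec x).

Lemma Dfun_mk n (s : V n -> bool) b v : Dfun s (mk b v) = mk (b (+) s v) v.
Proof. by rewrite /Dfun vec_mk sg_mk. Qed.

Lemma DfunK n (s : V n -> bool) : involutive (Dfun s).
Proof. by move=> x; rewrite -[x]mkK !Dfun_mk addbK. Qed.

Definition D n (s : V n -> bool) : {perm Qt n} := perm (inv_inj (DfunK s)).

Lemma D_mk n (s : V n -> bool) b v : D s (mk b v) = mk (b (+) s v) v.
Proof. by rewrite permE Dfun_mk. Qed.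

Lemma perm_mkP n (f g : {perm Qt n}) :
  (forall b v, f (mk b v) = g (mk b v)) -> f = g.
Proof. by move=> fg; apply/permP => x; rewrite -[x]mkK. Qed.

Lemma eq_D n (s t : V n -> bool) : s =1 t -> D s = D t.
Proof. by move=> st; apply: perm_mkP => b v; rewrite !D_mk st. Qed.

Lemma D_inj n (s t : V n -> bool) : D s = D t -> s =1 t.
Proof.
move=> eqD v; have := congr1 (@sg n) (congr1 (fun f => fun_of_perm f (mk false v)) eqD).
by rewrite !D_mk !sg_mk.
Qed.

Lemma D_mul n (s t : V n -> bool) : (D s * D t)%g = D (fun v => s v (+) t v).
Proof. by apply: perm_mkP => b v; rewrite permM !D_mk addbA. Qed.

Lemma D_commute n (s t : V n -> bool) : commute (D s) (D t).
Proof. by rewrite /commute !D_mul; apply: eq_D => v; rewrite addbC. Qed.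

Lemma D_false n : D (fun _ : V n => false) = 1%g.
Proof. by apply: perm_mkP => b v; rewrite D_mk perm1 addbF. Qed.

Lemma D_sqr n (s : V n -> bool) : (D s * D s)%g = 1%g.
Proof. by rewrite D_mul -D_false; apply: eq_D => v; rewrite addbb. Qed.

Lemma D_big n (I : Type) (r : seq I) (F : I -> V n -> bool) :
  D (fun v => \big[addb/false]_(i <- r) F i v) = (\prod_(i <- r) D (F i))%g.
Proof.
elim: r => [|i r IH]; rewrite ?big_nil ?big_cons.
  by rewrite -D_false; apply: eq_D => v; rewrite big_nil.
by rewrite -IH D_mul; apply: eq_D => v; rewrite big_cons.
Qed.

(** * Left translations and the group they generate *)

Lemma qmulI n (x : Qt n) : injective (qmul x).
Proof.
move=> y z; rewrite -[x]mkK -[y]mkK -[z]mkK !mul_mk => eq_xyz.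
have := congr1 (@sg n) eq_xyz; have := congr1 (@vec n) eq_xyz.
by rewrite !vec_mk !sg_mk => /vaddI -> /addIb/addbI ->.
Qed.

Definition L n (x : Qt n) : {perm Qt n} := perm (@qmulI n x).

Lemma L_mk n a (u : V n) b v :
  L (mk a u) (mk b v) = mk (a (+) b (+) eps u v) (vadd u v).
Proof. by rewrite permE mul_mk. Qed.

Lemma LtransP n (f : {perm Qt n}) :
  reflect (exists x, f = L x) (f \in Ltrans n).
Proof.
rewrite inE; apply: (iffP existsP) => -[x fx]; exists x.
  by apply/permP => a; rewrite permE; apply/eqP/(forallP fx).
by apply/forallP => a; rewrite fx permE.
Qed.

Lemma L_Mlt n (x : Qt n) : L x \in Mlt_l n.
Proof. by apply: mem_gen; apply/LtransP; exists x. Qed.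

(** Products of permutations apply the left factor first, so the composite is compared with
    translation by $vu$. *)
Lemma L_mul n a b (u v : V n) :
  (L (mk a u) * L (mk b v))%g
    = (D (assoc_sign v u) * L (mk (a (+) b (+) eps v u) (vadd v u)))%g.
Proof.
apply: perm_mkP => c w; rewrite !permM D_mk !L_mk vaddA; congr (mk _ _).
rewrite /assoc_sign; case: a; case: b; case: c; do 4 case: (eps _ _) => //.
Qed.

Lemma D_assoc_Mlt n (u v : V n) : D (assoc_sign v u) \in Mlt_l n.
Proof.
have /esym/(canRL (mulgK _)) -> := L_mul false false u v.
by rewrite groupMl ?groupV ?groupMl ?L_Mlt.
Qed.

(** $L_{(x^*,1)}L_{(1,1)}$ sends $(y,0)$ to $-(yx^*,0)$, while $L_{-(x,0)}$ sends it to $-(xy,0)$.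
    By [epsC] these differ by the conjugation signs of $y$ and $x+y$; likewise on $(y,1)$. *)
Lemma D_delta_Mlt n (x : V n) :
  D (fun v : V n.+1 => (v.1 == v0 n) (+) (v.1 == x)) \in Mlt_l n.+1.
Proof.
suff -> : D (fun v : V n.+1 => (v.1 == v0 n) (+) (v.1 == x))
  = (L (mk false ((v0 n, true) : V n.+1)) * L (mk (conj_sign x) ((x, true) : V n.+1))
      * (L (mk true ((x, false) : V n.+1)))^-1)%g.
  by rewrite groupMl ?groupV ?groupMl ?L_Mlt.
apply: (canRL (mulgK _)); apply: (@perm_mkP n.+1) => b [y d].
rewrite !permM D_mk !(@L_mk n.+1).
have [e0 e0'] := eps0v y; have := epsC x y; rewrite !conj_signE vadd_eq0.
case: d => /=; rewrite vadd0v ?e0 ?e0' ?conj_signE ?(vaddC y x) => ->; congr (mk _ _, _).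
all: by case: b; case: (eps x y); case: (x == v0 n); case: (y == v0 n); case: (y == x).
Qed.

Lemma D_code_Mlt n (c : bool) (s : V n.+1 -> bool) :
  1 < n -> code c s -> D s \in Mlt_l n.+1.
Proof.
move=> n_gt1; suff even_case t : code false t -> D t \in Mlt_l n.+1.
  case: c => [s_code|]; last exact: even_case.
  (* Two distinct nonzero vectors anticommute: they and their sum all have conjugation sign
     [true]. *)
  have [z [x ezx]] : exists z x : V n,
      conj_sign z (+) conj_sign x (+) conj_sign (vadd z x).
    case: n n_gt1 {s s_code even_case} => [|[|n]] // _.
    by exists ((v0 n, true), false), ((v0 n, false), true).
  have A_code := code_assoc_sign z x false false n_gt1; rewrite ezx in A_code.
  rewrite -(groupMr _ (@D_assoc_Mlt n.+1 (x, false) (z, false))).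
  by rewrite D_mul; apply: even_case; apply: (codeD s_code A_code).
case=> t_ext t_sum.
have -> : D t = D (fun v : V n.+1 => 
    \big[addb/false]_(x <- [seq x <- index_enum (V n) | (x != v0 n) && t (x, false)])
      ((v.1 == v0 n) (+) (v.1 == x))).
  apply: eq_D => -[y d]; rewrite big_filter /=.
  have -> : t (y, d) = t (y, false) by case: d; rewrite ?t_ext ?addbF.
  case: (eqVneq y (v0 n)) => [->|y_neq0] /=.
    (* Every pair $\{0,x\}$ contributes at 0; even weight gives their number the parity of [t]
       there. *)
    move: t_sum; rewrite (bigD1 (v0 n)) //= -[RHS](addbb (t (v0 n, false))) => /addbI <-.
    rewrite (bigID (fun x => t (x, false))) /= [X in _ (+) X]big1 ?addbF; last first.
      by move=> x /andP[_ /negbTE].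
    apply: eq_bigr => x /andP[x_neq0 ->].
    by rewrite eq_sym (negbTE x_neq0).
  case: (boolP (t (y, false))) => ty.
    rewrite (bigD1 y) ?y_neq0 //= eqxx big1 // => x /andP[_ /negbTE].
    by rewrite eq_sym.
  by rewrite big1 // => x /andP[_ tx]; apply: contraNF ty => /eqP ->.
rewrite D_big; apply: group_prod => x _; exact: D_delta_Mlt.
Qed.

(** * Left inner mappings as sign changes *)

Lemma D_L_mul n (s : V n -> bool) (x z : Qt n) :
  exists y, (D s * L x * L z
    = D (fun v => s v (+) assoc_sign (vec z) (vec x) v) * L y)%g.
Proof.
exists (mk (sg x (+) sg z (+) eps (vec z) (vec x)) (vadd (vec z) (vec x))).
by rewrite -D_mul -!mulgA -L_mul !mkK.
Qed.

(** Induction on a word in left translations, each new letter adding an associator sign; by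
    finiteness such words give the whole group. *)
Lemma Mlt_l_elim n (f : {perm Qt n.+1}) : 1 < n -> f \in Mlt_l n.+1 ->
  exists c s x, code c s /\ f = (D s * L x)%g.
Proof.
move=> n_gt1 /gen_prodgP[k [g Lg ->]] {f}.
elim: k g Lg => [|k IH] g Lg.
  exists false, (fun _ => false), (qone n.+1); split.
    exact: code_const (ltnW n_gt1).
  rewrite big_ord0 D_false mul1g; apply: perm_mkP => b v.
  by rewrite perm1 mk_one L_mk vadd0v (eps0v v).1 addbF.
have [|c [s [x [s_code eq_prod]]]] := IH (fun i => g (widen_ord (leqnSn k) i)).
  by move=> i; apply: Lg.
have /LtransP[z eq_z] := Lg ord_max; have [y eq_y] := D_L_mul s x z.
case: (vec x) (vec z) eq_y => [u a] [v b] eq_y.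
rewrite big_ord_recr; do 3 eexists; split; last by rewrite /= eq_prod eq_z eq_y.
exact: (codeD s_code (code_assoc_sign v u b a n_gt1)).
Qed.

Lemma Inn_lP n (f : {perm Qt n.+1}) : 1 < n ->
  (f \in Inn_l n.+1) <->
  exists c s, [/\ code c s, s (v0 n.+1) = false & f = D s].
Proof.
move=> n_gt1; rewrite inE; split.
  case/andP=> /(Mlt_l_elim n_gt1)[c [s [x [s_code ->]]]].
  rewrite permM mk_one D_mk -[x]mkK L_mk => /eqP fix1.
  have := congr1 (@vec _) fix1; have := congr1 (@sg _) fix1.
  rewrite !sg_mk !vec_mk vaddC vadd0v (eps0v _).2 addbF => sgx vecx.
  (* Fixing 1 forces $x=\pm1$ with sign [s (v0 _)], so [L x] is a constant sign, absorbed into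
     [s]. *)
  exists (c (+) false), (fun v => s v (+) s (v0 _)); split.
  - exact: codeD s_code (code_const _ (ltnW n_gt1)).
  - by rewrite addbb.
  - apply: perm_mkP => b v; rewrite vecx permM !D_mk L_mk vadd0v (eps0v v).1 addbF.
    congr (mk _ _); move: sgx; rewrite addFb.
    by case: (sg x); case: (s (v0 _)); case: b; case: (s v).
case=> c [s [s_code s0 ->]]; by rewrite (D_code_Mlt n_gt1 s_code) andTb mk_one D_mk s0.
Qed.

(** * Right translations *)

Lemma RtransE n : Rtrans n = (Ltrans n :^ D (@conj_sign n))%g.
Proof.
have DV : (D (@conj_sign n))^-1%g = D (@conj_sign n).
  by apply/eqP; rewrite eq_invg_mul D_sqr.
apply/setP => f; rewrite mem_conjg DV.
have conjE g a u : (g ^ D (@conj_sign n))%g (mk a u)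
    = D (@conj_sign n) (g (mk (a (+) conj_sign u) u)).
  by rewrite conjgE DV !permM D_mk.
rewrite inE; apply/existsP/LtransP => -[x fx].
  exists (qconj x); apply: perm_mkP => a u; rewrite conjE.
  rewrite (eqP (forallP fx _)) -[x]mkK conj_mk mul_mk D_mk L_mk epsC (vaddC (vec x)).
  congr (mk _ _); case: a; case: (sg x); case_bools.
exists (qconj x); apply/forallP => y.
have -> : f = (L x ^ D (@conj_sign n))%g.
  by rewrite -fx -conjgM D_sqr conjg1.
rewrite -[y]mkK conjE -[x]mkK L_mk D_mk conj_mk mul_mk epsC (vaddC (vec x)).
apply/eqP; congr (mk _ _); case: (sg y); case: (sg x); case_bools.
Qed.

(** The conjugation of the loop fixes 1 and exchanges the two groups; commuting with sign changes,
    it centralizes the left one. *)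
Lemma Inn_rE n : 1 < n -> Inn_r n.+1 = Inn_l n.+1.
Proof.
move=> n_gt1; set J := D (@conj_sign n.+1).
have JJ : (J * J)%g = 1%g by exact: D_sqr.
have JV : (J^-1)%g = J by apply/eqP; rewrite eq_invg_mul JJ.
have J1 : J (qone n.+1) = qone n.+1 by rewrite mk_one D_mk conj_signE eqxx.
have Mlt_rE f : (f \in Mlt_r n.+1) = ((f ^ J)%g \in Mlt_l n.+1).
  by rewrite /Mlt_r RtransE genJ mem_conjg JV.
have D_J s : (D s ^ J)%g = D s.
  rewrite conjgE JV /J !D_mul; apply: eq_D => v.
  by rewrite addbC addbK.
have InnJ f : f \in Inn_l n.+1 -> (f ^ J)%g = f.
  by case/(Inn_lP f n_gt1) => c [s [_ _ ->]]; apply: D_J.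
apply/setP => f; apply/idP/idP => [|fI].
  rewrite inE Mlt_rE => /andP[fM /eqP f1].
  have fJI : (f ^ J)%g \in Inn_l n.+1.
    by rewrite inE fM conjgE JV !permM J1 f1 J1 eqxx.
  by have := InnJ _ fJI; rewrite -conjgM JJ conjg1 => ->.
by rewrite inE Mlt_rE InnJ //; rewrite inE in fI.
Qed.

(** * Counting the words *)

(* The marked point [e] encodes the free twist [c] of a code word, because the
   bit at [(e, false)] is already determined by the parity condition. *)
Definition code_word n (e : V n) (u : {set V n}) (v : V n.+1) : bool :=
  (if v.1 == e then \big[addb/false]_(z | z != e) (z \in u) else v.1 \in u)
    (+) (v.2 && (e \in u)).

Lemma code_code_word n (e : V n) (u : {set V n}) : code (e \in u) (code_word e u).
Proof.
split=> [y|]; first by rewrite /code_word /= addbF.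
rewrite (bigD1 e) //= /code_word /= eqxx addbF.
under [X in _ (+) X]eq_bigr => y /negbTE y_neq do rewrite y_neq addbF.
by rewrite addbb.
Qed.

Lemma code_word_inj n (e : V n) (u u' : {set V n}) :
  code_word e u =1 code_word e u' -> u = u'.
Proof.
move=> eq_uu'; apply/setP => y; case: (eqVneq y e) => [->|/negbTE y_neq].
  have := eq_uu' (e, true); have := eq_uu' (e, false).
  by rewrite /code_word /= eqxx !addbF => -> /addbI.
by have := eq_uu' (y, false); rewrite /code_word /= y_neq !addbF.
Qed.

(** The set [u] records [c] at [e] and the first half of [s] elsewhere. As [e] is nonzero,
    [s (v0 n.+1)] is the bit of [u] at 0. *)
Lemma code_word_surj n (e : V n) c (s : V n.+1 -> bool) :
  e != v0 n -> code c s -> s (v0 n.+1) = false ->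
  exists2 u : {set V n}, v0 n \notin u & s =1 code_word e u.
Proof.
move=> e_neq0 [s_ext s_sum] s0.
exists [set y | if y == e then c else s (y, false)].
  by rewrite inE eq_sym (negbTE e_neq0); move: s0 => /= ->.
move=> [y d]; rewrite /code_word inE eqxx.
have -> : s (y, d) = s (y, false) (+) (d && c).
  by case: d; rewrite ?s_ext ?addbF.
congr (_ (+) _); rewrite /= inE; case: eqP => [->|//].
under eq_bigr => z /negbTE z_neq do rewrite inE z_neq.
by move: s_sum; rewrite (bigD1 e) //= -[RHS](addbb (s (e, false))) => /addbI ->.
Qed.

Lemma Inn_l_code_words n (e : V n) : 1 < n -> e != v0 n ->
  Inn_l n.+1 = [set D (code_word e u) | u in powerset [set~ v0 n]].
Proof.
move=> n_gt1 e_neq0; apply/setP => f; apply/idP/imsetP.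
  case/(Inn_lP f n_gt1) => c [s [s_code s0 ->]].
  have [u u0 eq_su] := code_word_surj e_neq0 s_code s0.
  by exists u; [rewrite powersetE subsetC sub1set inE | apply: eq_D].
case=> u; rewrite powersetE subsetC sub1set inE => u0 ->.
apply/(Inn_lP _ n_gt1); exists (e \in u), (code_word e u); split=> //.
  exact: code_code_word.
by rewrite /code_word /= eq_sym (negbTE e_neq0) (negbTE u0).
Qed.

Lemma card_V n : #|V n| = 2 ^ n.
Proof. by elim: n => [|n IH]; rewrite ?card_unit // card_prod IH card_bool expnSr. Qed.

(** One free bit for each of the $2^n-1$ nonzero vectors. *)
Lemma card_Inn_l n : 1 < n -> #|Inn_l n.+1| = 2 ^ (2 ^ n - 1).
Proof.
move=> n_gt1; have [e e_neq0] : exists e : V n, e != v0 n.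
  case: n n_gt1 => // n _; exists (v0 n, true).
  by rewrite -pair_eqE /pair_eq /= andbF.
rewrite (Inn_l_code_words n_gt1 e_neq0) card_imset; last first.
  by move=> u u' /D_inj /code_word_inj.
by rewrite card_powerset cardsC1 card_V subn1.
Qed.

Theorem mainTheorem16 (n : nat) (hn : 3 <= n) :
  Inn_l n = Inn_r n /\ (2.-abelem (Inn_l n))%g /\ #|Inn_l n| = 2 ^ (2 ^ n.-1 - 1).
Proof.
case: n hn => // n n_gt1; have card_Inn := card_Inn_l n_gt1.
split; first by rewrite Inn_rE.
split=> //; rewrite /abelem /pgroup card_Inn pnatX pnat_id //=; apply/andP; split.
  apply/centsP => f /(Inn_lP f n_gt1)[c [s [_ _ ->]]].
  move=> g /(Inn_lP g n_gt1)[d [t [_ _ ->]]].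
  exact: (@D_commute n.+1).
apply/exponentP => f /(Inn_lP f n_gt1)[c [s [_ _ ->]]].
by rewrite expgS expg1 (@D_sqr n.+1).
Qed.
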